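(* Let $\Gamma$ be a finite group, $(G,\phi)$ a $\Gamma$-symmetric looped simple graph, $\tau:\Gamma\to O(\mathbb{R}^2)$ a homomorphism, and $(G,p,q)$ a linearly constrained framework in $\mathbb{R}^2$ that is $\Gamma$-symmetric with respect to $\phi$ and $\tau$. If $(G,p,q)$ is isostatic, then $\chi(P_{E,L})=\chi(\tau\otimes P_V)$.
   Context: A looped simple graph $G=(V,E,L)$: finite vertex set $V=\{v_1,\dots,v_{|V|}\}$, edge set $E$ (unordered pairs of distinct vertices, no multiple edges), finite loop set $L=\{l_1,\dots,l_{|L|}\}$, each loop incident to one vertex. A $\Gamma$-symmetric graph $(G,\phi)$: $\phi:\Gamma\to\mathrm{Aut}(G)$ a homomorphism, automorphisms being pairs (permutation of $V$, permutation of $L$) preserving adjacency and vertex–loop incidence; $\gamma v,\gamma l$ denote images. $\gamma$ fixes loop $l$ if $\gamma l=l$ (loops can only be fixed by elements of order $\le 2$). A linearly constrained framework $(G,p,q)$: injective $p:V\to\mathbb{R}^2$, $q:L\to\mathbb{R}^2$; its rigidity matrix $R(G,p,q)$ is the $(|E|+|L|)\times 2|V|$ matrix whose row for edge $v_iv_j$ has $p(v_i)-p(v_j)$ in the two columns of $v_i$, $p(v_j)-p(v_i)$ in the columns of $v_j$, zeros elsewhere, and whose row for a loop $l$ at $v_i$ has $q(l)$ in the columns of $v_i$ and zeros elsewhere. It is isostatic if $\operatorname{rank}R=2|V|$ and the rows are linearly independent. $(G,p,q)$ is $\Gamma$-symmetric w.r.t. $\phi,\tau$ if $\tau(\gamma)p(v)=p(\gamma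 v)$ for all $v,\gamma$; $\tau(\gamma)q(l)=q(\gamma l)$ for all $l$ and $\gamma$ of order not $2$; $\tau(\gamma)q(l)=-q(l)$ if $\tau(\gamma)$ is the half-turn and $\gamma$ fixes $l$; $\tau(\gamma)q(l)=\pm q(l)$ if $\tau(\gamma)$ is a reflection and $\gamma$ fixes $l$. Representations: $(\tau\otimes P_V)(\gamma)$ is the linear map on $\mathbb{R}^{2|V|}=\bigoplus_{v\in V}\mathbb{R}^2$ sending $u=(u_v)_{v}$ to the vector whose $\gamma v$-component is $\tau(\gamma)u_v$ (the Kronecker product of the vertex permutation matrix $P_V(\gamma)$ with $\tau(\gamma)$). $P_E(\gamma)$ is the permutation matrix on $\mathbb{R}^{|E|}$ with $(P_E(\gamma)z)_{\gamma e}=z_e$, and $P_L(\gamma)$ similarly on $\mathbb{R}^{|L|}$; $P_L^*(\gamma)$ is obtained from $P_L(\gamma)$ by replacing the diagonal entry $1$ for a loop $l$ fixed by $\gamma$ with $-1$ whenever $\tau(\gamma)q(l)=-q(l)$. $P_{E,L}=P_E\oplus P_L^*$. For a representation $\rho$ of $\Gamma$ and a fixed ordering $\gamma_1,\dots,\gamma_{|\Gamma|}$ of $\Gamma$, the character $\chi(\rho)$ is the vector $(\operatorname{tr}\rho(\gamma_i))_i$.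
   Formalization: The definition of a Γ-symmetric framework is completed by requiring τ(γ)q(l)=±q(γl) when γ has order 2 and does not fix the loop l; without this the claim fails (half-turn swapping two independent loops at one vertex at the origin). *)

(* Defs.v *)
From HB Require Import structures.
From mathcomp Require Import all_boot all_order all_algebra all_fingroup.
From mathcomp Require Import mxrepresentation.
From mathcomp Require Import mxtens reals.

Set Implicit Arguments.
Unset Strict Implicit.
Unset Printing Implicit Defensive.

Import GRing.Theory.
Local Open Scope ring_scope.

(* An edge is a two-element set of vertices; several loops may share a vertex. *)
Record looped_graph := LoopedGraph {
  vertex : finType;
  loop : finType;
  edges : {set {set vertex}};
  edges_card2 : {in edges, forall e : {set vertex}, #|e| = 2%N};
  loop_at : loop -> vertex
}.

Notation vloop_perm G := ({perm vertex G} * {perm loop G})%type.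

Definition is_automorphism (G : looped_graph) (s : vloop_perm G) : Prop :=
  (forall v w : vertex G,
      ([set s.1 v; s.1 w] \in edges G) = ([set v; w] \in edges G)) /\
  (forall l : loop G, loop_at (s.2 l) = s.1 (loop_at l)).

(* Permutations of MathComp multiply from left to right,
   (s * t) x = t (s x), so phi h * phi g is the composite phi g \o phi h:
   the group acts on the left. *)
Definition symmetric_graph (gT : finGroupType) (G : looped_graph)
    (phi : gT -> vloop_perm G) : Prop :=
  (forall g : gT, is_automorphism (phi g)) /\
  (forall g h : gT, phi (g * h)%g = (phi h * phi g)%g).

Definition orthogonal_repr (R : realType) (gT : finGroupType)
    (tau : gT -> 'M[R]_2) : Prop :=
  mx_repr [set: gT] tau /\ (forall g : gT, tau g *m (tau g)^T = 1%:M).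

Definition is_half_turn (R : realType) (A : 'M[R]_2) : Prop := A = - 1%:M.

(* Reflection in the line orthogonal to the unit vector n. *)
Definition is_reflection (R : realType) (A : 'M[R]_2) : Prop :=
  exists n : 'cV[R]_2, n^T *m n = 1%:M /\ A = 1%:M - (n *m n^T) *+ 2.

Definition is_framework (R : realType) (G : looped_graph)
    (p : vertex G -> 'cV[R]_2) (q : loop G -> 'cV[R]_2) : Prop :=
  injective p.

(* An element of order 2 may reverse the normal of a loop that it moves, just as
   a reflection may reverse the normal of a loop that it fixes. *)
Definition symmetric_framework (R : realType) (gT : finGroupType)
    (G : looped_graph) (phi : gT -> vloop_perm G) (tau : gT -> 'M[R]_2)
    (p : vertex G -> 'cV[R]_2) (q : loop G -> 'cV[R]_2) : Prop :=
  [/\ forall (g : gT) (v : vertex G), tau g *m p v = p ((phi g).1 v),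
      forall (g : gT) (l : loop G), #[g]%g <> 2%N ->
        tau g *m q l = q ((phi g).2 l),
      forall (g : gT) (l : loop G), #[g]%g = 2%N -> (phi g).2 l <> l ->
        tau g *m q l = q ((phi g).2 l) \/ tau g *m q l = - q ((phi g).2 l),
      forall (g : gT) (l : loop G), is_half_turn (tau g) -> (phi g).2 l = l ->
        tau g *m q l = - q l
    & forall (g : gT) (l : loop G), is_reflection (tau g) -> (phi g).2 l = l ->
        tau g *m q l = q l \/ tau g *m q l = - q l].

(* Vertices, edges and loops are numbered by enum_val; coordinate k of the
   vertex numbered i has column mxtens_index (i, k), as in P *t T. For v an end
   of the edge e, the set e :\ v contains the other end only. *)
Definition edge_rows (R : realType) (G : looped_graph)
    (p : vertex G -> 'cV[R]_2) : 'M[R]_(#|edges G|, #|vertex G| * 2) :=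
  \matrix_(i, c)
    let e : {set vertex G} := enum_val i in
    let v : vertex G := enum_val (mxtens_unindex c).1 in
    let k := (mxtens_unindex c).2 in
    if v \in e then \sum_(w in e :\ v) (p v - p w) k 0 else 0.

Definition loop_rows (R : realType) (G : looped_graph)
    (q : loop G -> 'cV[R]_2) : 'M[R]_(#|loop G|, #|vertex G| * 2) :=
  \matrix_(i, c)
    let l : loop G := enum_val i in
    let v : vertex G := enum_val (mxtens_unindex c).1 in
    let k := (mxtens_unindex c).2 in
    if v == loop_at l then q l k 0 else 0.

Definition rigidity_matrix (R : realType) (G : looped_graph)
    (p : vertex G -> 'cV[R]_2) (q : loop G -> 'cV[R]_2) :
    'M[R]_(#|edges G| + #|loop G|, #|vertex G| * 2) :=
  col_mx (edge_rows p) (loop_rows q).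

Definition isostatic (R : realType) (G : looped_graph)
    (p : vertex G -> 'cV[R]_2) (q : loop G -> 'cV[R]_2) : Prop :=
  \rank (rigidity_matrix p q) = (2 * #|vertex G|)%N /\
  row_free (rigidity_matrix p q).

(* Permutation matrices act on column vectors: column j has its 1 in the row of
   the image of j. This is the transpose of the convention of perm_mx. *)
Section Representations.
Variables (R : realType) (gT : finGroupType) (G : looped_graph).
Variables (phi : gT -> vloop_perm G) (tau : gT -> 'M[R]_2).
Variable q : loop G -> 'cV[R]_2.

Definition P_V (g : gT) : 'M[R]_#|vertex G| :=
  \matrix_(i, j) (enum_val i == (phi g).1 (enum_val j))%:R.

Definition tau_tens_P_V (g : gT) : 'M[R]_(#|vertex G| * 2) := P_V g *t tau g.

Definition P_E (g : gT) : 'M[R]_#|edges G| :=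
  \matrix_(i, j) (enum_val i == (phi g).1 @: (enum_val j : {set vertex G}))%:R.

Definition P_L (g : gT) : 'M[R]_#|loop G| :=
  \matrix_(i, j) (enum_val i == (phi g).2 (enum_val j))%:R.

Definition P_L_star (g : gT) : 'M[R]_#|loop G| :=
  \matrix_(i, j)
    let l : loop G := enum_val j in
    if [&& i == j, (phi g).2 l == l & tau g *m q l == - q l]
    then -1 else P_L g i j.

Definition P_EL (g : gT) : 'M[R]_(#|edges G| + #|loop G|) :=
  block_mx (P_E g) 0 0 (P_L_star g).

End Representations.

Definition chi (R : realType) (gT : finGroupType) (o : 'I_#|gT| -> gT) (n : nat)
    (rho : gT -> 'M[R]_n) : 'rV[R]_#|gT| :=
  \row_i \tr (rho (o i)).

(* Main.v *)
(** Let M be the rigidity matrix and T g := P_V g *t tau g. Symmetry of the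
    framework gives M *m T g = S g *m M, where S g is a signed permutation matrix
    of the rows. Isostaticity makes M invertible, so T g and S g have the same
    trace. The signs of S g at loops moved by g are irrelevant to the trace, and
    at a fixed loop l they agree with those of P_L_star because q l is nonzero
    and tau g is the identity, the half-turn or a reflection when g has order 2. *)
Require Import Defs.
From mathcomp Require Import all_boot all_order all_algebra all_fingroup.
From mathcomp Require Import reals.
From mathcomp Require Import mxrepresentation mxtens ring lra.

Set Implicit Arguments.
Unset Strict Implicit.
Unset Printing Implicit Defensive.

Import Order.TTheory GRing.Theory Num.Theory.
Local Open Scope ring_scope.

Lemma mx2P (R : Type) (A B : 'M[R]_2) :
  A 0 0 = B 0 0 -> A 0 1 = B 0 1 -> A 1 0 = B 1 0 -> A 1 1 = B 1 1 -> A = B.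
Proof.
move=> h00 h01 h10 h11; apply/matrixP=> i j.
have ord2 (k : 'I_2) : k = 0 \/ k = 1.
  by case: k => [[|[|//]] ltk]; [left | right]; apply: val_inj.
by case: (ord2 i) => ->; case: (ord2 j) => ->.
Qed.

(** Here $(x, y)$ is the unit normal of the mirror line. *)
Lemma is_reflection_entries (R : realType) (A : 'M[R]_2) (x y : R) :
    x ^+ 2 + y ^+ 2 = 1 ->
    A 0 0 = 1 - x ^+ 2 *+ 2 -> A 0 1 = - (x * y) *+ 2 ->
    A 1 0 = - (x * y) *+ 2 -> A 1 1 = 1 - y ^+ 2 *+ 2 ->
  is_reflection A.
Proof.
move=> xy1 A00 A01 A10 A11.
exists (\col_i (if i == 0 then x else y)); split.
  apply/matrixP=> i j; rewrite !ord1 !mxE !big_ord_recl big_ord0 !mxE /=.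
  by rewrite -xy1; ring.
by apply: mx2P; rewrite !mxE ?big_ord_recl ?big_ord0 !mxE /= ?(A00, A01, A10, A11);
  ring.
Qed.

(** Orthogonality and $A^2 = 1$ make $A$ symmetric, so $A^2 = 1$ becomes three equations in the
    entries $a, b, d$. The off-diagonal one, $b (a + d) = 0$, splits the proof by the trace: a
    nonzero trace leaves $\pm 1$, a zero trace a reflection. *)
Lemma orthogonal_involutionP (R : realType) (A : 'M[R]_2) :
    A *m A^T = 1%:M -> A *m A = 1%:M ->
  [\/ A = 1%:M, is_half_turn A | is_reflection A].
Proof.
move=> AAt AA.
have Asym : A^T = A by rewrite -[A^T]mul1mx -AA -mulmxA AAt mulmx1.
have A10 : A 1 0 = A 0 1 by rewrite -{1}Asym mxE.
have entry i j : A i 0 * A 0 j + A i 1 * A 1 j = (i == j)%:R.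
  have /matrixP/(_ i j) := AA.
  by rewrite !mxE !big_ord_recl big_ord0 addr0 => <-; congr (_ * _ + A i _ * A _ _);
    apply: val_inj.
have := entry 0 0; have := entry 0 1; have := entry 1 1; rewrite A10 /=.
set a := A 0 0; set b := A 0 1; set d := A 1 1 => e11 e01 e00.
have [da0|da_neq0] := eqVneq (a + d) 0; last first.
  have b0 : b = 0.
    have /eqP : b * (a + d) = 0 by rewrite -[RHS]e01; ring.
    by rewrite mulf_eq0 (negPf da_neq0) orbF => /eqP.
  have ad : d = a.
    have /eqP : (a - d) * (a + d) = 0.
      by transitivity ((a * a + b * b) - (b * b + d * d)); [ring|rewrite e00 e11 subrr].
    by rewrite mulf_eq0 (negPf da_neq0) orbF subr_eq0 => /eqP.
  have /eqP : (a - 1) * (a + 1) = 0.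
    by transitivity (a * a + b * b - 1); [rewrite b0; ring|rewrite e00 subrr].
  rewrite mulf_eq0 subr_eq0 addr_eq0 => /orP[]/eqP a1.
    by apply: Or31; apply: mx2P; rewrite ?A10 !mxE //= -/d ad.
  apply: Or32; apply: mx2P; rewrite ?A10 !mxE /= ?oppr0 //.
  by rewrite -/d ad.
have {}da0 : d = - a by apply/eqP; rewrite -addr_eq0 addrC da0.
(* The case $a = 1$ is separate because the general normal has first coordinate $x = 0$ there, and
   $x$ occurs as a denominator. *)
apply: Or33; have [a1|a_neq1] := eqVneq a 1.
  have b0 : b = 0.
    by apply/eqP; rewrite -sqrf_eq0 expr2; apply/eqP; move: e00; rewrite a1; lra.
  by apply: (@is_reflection_entries _ _ 0 1); rewrite ?A10 -/a -/b -/d ?da0 ?b0 ?a1; ring.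
have ha : 0 < (1 - a) / 2 by have : a < 1; [rewrite lt_neqAle a_neq1 /=; nra|lra].
(* The normal must satisfy $1 - 2x^2 = a$ and $-2xy = b$, which dictates $x$ and then $y =
   -b/(2x)$. *)
pose x := Num.sqrt ((1 - a) / 2).
have x2 : x ^+ 2 = (1 - a) / 2 by rewrite sqr_sqrtr // ltW.
have x_neq0 : x != 0 by rewrite sqrtr_eq0 -ltNge.
have y2 : (- b / (2 * x)) ^+ 2 = (1 + a) / 2.
  rewrite expr_div_n exprMn x2 sqrrN.
  have -> : b ^+ 2 = (1 - a) * (1 + a) by rewrite expr2; nra.
  by field; rewrite subr_eq0 eq_sym.
apply: (@is_reflection_entries _ _ x (- b / (2 * x)));
  rewrite ?A10 -/a -/b -/d ?x2 ?y2 ?da0; by field.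
Qed.

(* The row of index i is the covector (f i v)_v; s and c are the permutation and
   the signs of the rows. *)
Lemma signed_perm_intertwine (R : comNzRingType) (V : finType) (n m : nat)
    (g : V -> V) (A : 'M[R]_n) (f : 'I_m -> V -> 'cV[R]_n)
    (s : 'I_m -> 'I_m) (c : 'I_m -> R) :
    A^T *m A = 1%:M -> injective s ->
    (forall j v, f (s j) (g v) = c j *: (A *m f j v)) ->
  let M : 'M_(m, #|V| * n) := \matrix_(i, k)
    f i (enum_val (mxtens_unindex k).1) (mxtens_unindex k).2 0 in
  let P : 'M_#|V| := \matrix_(i, j) (enum_val i == g (enum_val j))%:R in
  M *m (P *t A) = (\matrix_(i, j) ((i == s j)%:R * c j)) *m M.
Proof.
move=> AtA s_inj fE M P; apply/matrixP=> i0 k0.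
(* An injective [s] on a finite type is onto, so every row has the form [s i]. *)
have [i <-] : exists i, s i = i0.
  by exists (invF s_inj i0); rewrite f_invF.
case: (mxtens_indexP k0) => a k.
rewrite !mxE (reindex_onto (@mxtens_index _ _) (@mxtens_unindex _ _)) /=; last first.
  by move=> ? _; rewrite mxtens_unindexK.
under eq_bigl do rewrite mxtens_indexK eqxx.
transitivity (\sum_(b < #|V|) \sum_l f (s i) (enum_val b) l 0 *
    ((enum_val b == g (enum_val a))%:R * A l k)).
  rewrite pair_bigA /=; apply: eq_bigr => -[b l] _.
  by rewrite !mxE !mxtens_indexK /=.
rewrite (bigD1 (enum_rank (g (enum_val a)))) //= [X in _ + X]big1 ?addr0; last first.
  move=> b bN; apply: big1 => l _; case: eqP => [bE|_]; last by rewrite mul0r mulr0.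
  by rewrite -bE enum_valK eqxx in bN.
rewrite enum_rankK eqxx fE (bigD1 i) //= [X in _ + X]big1 ?addr0; last first.
  by move=> j ji; rewrite !mxE inj_eq // eq_sym (negPf ji) !mul0r.
rewrite !mxE eqxx mul1r mxtens_indexK /=.
(* The sum over [l] pairs $A f$ with column [k] of $A$; orthogonality then cancels $A$. *)
transitivity (c i * (A^T *m (A *m f i (enum_val a))) k 0); last first.
  by rewrite mulmxA AtA mul1mx.
rewrite mxE mulr_sumr; apply: eq_bigr => l _.
by rewrite mul1r !mxE; ring.
Qed.

Lemma imset_edge (G : looped_graph) (s : vloop_perm G) (e : {set vertex G}) :
  is_automorphism s -> e \in edges G -> s.1 @: e \in edges G.
Proof.
move=> [edgeE _] eG; have /eqP/cards2P[v [w [_ eE]]] := edges_card2 eG.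
by rewrite eE imsetU1 imset_set1 edgeE -eE.
Qed.

(** A zero normal would give a zero row. Nonzero normals are what makes the sign at a fixed loop
    unambiguous. *)
Lemma row_free_loop_neq0 (R : realType) (G : looped_graph)
    (p : vertex G -> 'cV[R]_2) (q : loop G -> 'cV[R]_2) (l : loop G) :
  row_free (rigidity_matrix p q) -> q l != 0.
Proof.
move=> freeM; apply/eqP=> ql0.
pose i := rshift #|edges G| (enum_rank l).
have : delta_mx 0 i *m rigidity_matrix p q = 0 :> 'rV_(#|vertex G| * 2).
  rewrite -rowE; apply/rowP=> k; rewrite mxE col_mxEd !mxE /= enum_rankK ql0.
  by rewrite mxE if_same.
rewrite -(mul0mx _ (rigidity_matrix p q)) => /(row_free_inj freeM)/rowP/(_ i).
by rewrite !mxE !eqxx => /eqP; rewrite oner_eq0.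
Qed.

Section Symmetry.
Variables (R : realType) (gT : finGroupType) (G : looped_graph).
Variables (phi : gT -> vloop_perm G) (tau : gT -> 'M[R]_2).
Variables (p : vertex G -> 'cV[R]_2) (q : loop G -> 'cV[R]_2).
Hypotheses (hphi : symmetric_graph phi) (htau : orthogonal_repr tau).
Hypothesis hsym : symmetric_framework phi tau p q.

Lemma tau_trK (g : gT) : (tau g)^T *m tau g = 1%:M.
Proof. by apply: mulmx1C; case: htau. Qed.

(** The row of an edge is symmetric in its two ends, so the rows are permuted without signs. *)
Lemma edge_rows_intertwine (g : gT) :
  edge_rows p *m tau_tens_P_V phi tau g = P_E R phi g *m edge_rows p.
Proof.
have autg : is_automorphism (phi g) by case: hphi.
have [tau_p _ _ _ _] := hsym.
pose f (i : 'I_#|edges G|) v : 'cV[R]_2 :=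
  if v \in (enum_val i : {set vertex G})
  then \sum_(w in enum_val i :\ v) (p v - p w) else 0.
pose s (i : 'I_#|edges G|) :=
  enum_rank_in (enum_valP i) ((phi g).1 @: (enum_val i : {set vertex G})).
have sE i : enum_val (s i) = (phi g).1 @: (enum_val i : {set vertex G}).
  by rewrite enum_rankK_in // imset_edge // enum_valP.
have s_inj : injective s.
  move=> i j /(congr1 enum_val); rewrite !sE => /(imset_inj (@perm_inj _ _)).
  exact: enum_val_inj.
have fE j v : f (s j) ((phi g).1 v) = 1 *: (tau g *m f j v).
  rewrite scale1r /f sE mem_imset; last exact: perm_inj.
  case: ifP => _; last by rewrite mulmx0.
  have -> (e : {set vertex G}) : ((phi g).1 @: e) :\ (phi g).1 v = (phi g).1 @: (e :\ v).
    apply/setP=> w; rewrite -[w](permKV (phi g).1) !inE !mem_imset ?inE;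
      by [apply: perm_inj | rewrite inj_eq //; apply: perm_inj].
  rewrite big_imset /=; last by move=> ? ? _ _; apply: perm_inj.
  by rewrite mulmx_sumr; apply: eq_bigr => w _; rewrite mulmxBr !tau_p.
have := signed_perm_intertwine (tau_trK g) s_inj fE.
rewrite /= -/(P_V R phi g) -/(tau_tens_P_V phi tau g).
have -> : \matrix_(i, k)
    f i (enum_val (mxtens_unindex k).1) (mxtens_unindex k).2 0 = edge_rows p.
  apply/matrixP=> i k; rewrite !mxE /f; case: ifP => _; last by rewrite mxE.
  by rewrite summxE.
move=> ->; congr (_ *m _); apply/matrixP=> i j.
by rewrite !mxE mulr1 -sE (inj_eq enum_val_inj).
Qed.

(** The symmetry conditions give this directly except at a loop fixed by an element of order 2;
    there [tau g] is an orthogonal involution, and the classification applies. *)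
Lemma tau_loop_pm (g : gT) (l : loop G) :
  tau g *m q l = q ((phi g).2 l) \/ tau g *m q l = - q ((phi g).2 l).
Proof.
have [_ tau_q moved_q half_q refl_q] := hsym.
have [g2|/eqP g_neq2] := eqVneq #[g]%g 2%N; last by left; apply: tau_q.
have [fixl|/eqP ?] := eqVneq ((phi g).2 l) l; last exact: moved_q.
have [[tau1 tauM] tau_tr] := htau.
have tau2 : tau g *m tau g = 1%:M.
  by rewrite -tauM ?inE // -expg2 (_ : g ^+ 2 = 1)%g // -(expg_order g) g2.
rewrite fixl; have [taug|taug|taug] := orthogonal_involutionP (tau_tr g) tau2.
- by left; rewrite taug mul1mx.
- by right; apply: half_q.
- exact: refl_q.
Qed.

(** [S] is only claimed to share its trace with [P_L_star]: at loops moved by [g] the signs may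
    differ, but those entries lie off the diagonal. *)
Lemma loop_rows_intertwine (g : gT) :
    (forall l, q l != 0) ->
  exists2 S : 'M[R]_#|loop G|,
    loop_rows q *m tau_tens_P_V phi tau g = S *m loop_rows q
    & \tr S = \tr (P_L_star phi tau q g).
Proof.
move=> q_neq0; have [_ loop_at_phi] : is_automorphism (phi g) by case: hphi.
pose f (i : 'I_#|loop G|) v : 'cV[R]_2 :=
  if v == loop_at (enum_val i) then q (enum_val i) else 0.
pose s (i : 'I_#|loop G|) := enum_rank ((phi g).2 (enum_val i)).
pose c (i : 'I_#|loop G|) : R :=
  if tau g *m q (enum_val i) == q ((phi g).2 (enum_val i)) then 1 else -1.
have s_inj : injective s.
  by move=> i j /enum_rank_inj/perm_inj; apply: enum_val_inj.
have fE j v : f (s j) ((phi g).1 v) = c j *: (tau g *m f j v).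
  rewrite /f /c enum_rankK loop_at_phi (inj_eq perm_inj).
  case: ifP => _; last by rewrite mulmx0 scaler0.
  case: eqP => [->|tauN]; first by rewrite scale1r.
  by have [/tauN//|->] := tau_loop_pm g (enum_val j); rewrite scaleN1r opprK.
have := signed_perm_intertwine (tau_trK g) s_inj fE.
rewrite /= -/(P_V R phi g) -/(tau_tens_P_V phi tau g).
have -> : \matrix_(i, k)
    f i (enum_val (mxtens_unindex k).1) (mxtens_unindex k).2 0 = loop_rows q.
  by apply/matrixP=> i k; rewrite !mxE /f; case: ifP => _ //; rewrite mxE.
move=> fS; eexists; first exact: fS.
apply: eq_bigr => i _; rewrite !mxE eqxx /=.
have -> : (i == s i) = ((phi g).2 (enum_val i) == enum_val i).
  by rewrite -(inj_eq enum_val_inj) enum_rankK eq_sym.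
rewrite [enum_val i == _]eq_sym /c; case: eqP => [fixi|_] /=; last by rewrite mul0r.
rewrite mul1r fixi; case: eqP => [->|tauN].
  (* Were both signs valid, [c] would choose $1$ and [P_L_star] $-1$; but then $2 q(l) = 0$, against
     [q_neq0]. *)
  case: eqP => // /eqP; rewrite -addr_eq0 -mulr2n -scaler_nat scaler_eq0 pnatr_eq0.
  by rewrite (negPf (q_neq0 _)).
by have := tau_loop_pm g (enum_val i); rewrite fixi => -[/tauN//|->]; rewrite eqxx.
Qed.

End Symmetry.

Theorem theorem3p3 (R : realType) (gT : finGroupType) (o : 'I_#|gT| -> gT)
    (ho : bijective o)
    (G : looped_graph) (phi : gT -> vloop_perm G) (tau : gT -> 'M[R]_2)
    (p : vertex G -> 'cV[R]_2) (q : loop G -> 'cV[R]_2)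
    (hphi : symmetric_graph phi) (htau : orthogonal_repr tau)
    (hpq : is_framework p q) (hsym : symmetric_framework phi tau p q)
    (hiso : isostatic p q) :
  chi o (P_EL phi tau q) = chi o (tau_tens_P_V phi tau).
Proof.
have [rankM freeM] := hiso.
apply/rowP=> i; rewrite !mxE; move: (o i) => g.
have fullM : row_full (rigidity_matrix p q).
  by rewrite /row_full rankM mulnC.
have [S SE trS] := loop_rows_intertwine hphi htau hsym g
  (fun l => row_free_loop_neq0 l freeM).
have MT : rigidity_matrix p q *m tau_tens_P_V phi tau g =
    block_mx (P_E R phi g) 0 0 S *m rigidity_matrix p q.
  rewrite mul_block_col !mul0mx addr0 add0r mul_col_mx -SE.
  by rewrite (edge_rows_intertwine hphi htau hsym).
rewrite mxtrace_block -trS -(mxtrace_block _ 0 0) -[block_mx _ _ _ _]mulmx1.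
(* The row and column counts are equal but not convertible, so the pseudo-inverse serves as inverse:
   on the right by independence of the rows, on the left by full column rank. Cyclicity of the trace
   finishes the conjugation argument. *)
rewrite -(mulmxVp freeM) mulmxA -MT -mulmxA mxtrace_mulC -mulmxA.
by rewrite mulVpmx // mulmx1.
Qed.
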